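(* Let $a,b,c$ be positive reals with $a\neq b$, $m$ a positive integer, $k$ a nonnegative integer, $r$ a positive integer, $\overline{\alpha}_r=(\alpha_0,\dots,\alpha_{r-1})$ complex numbers, and let $\alpha$ be a complex parameter. Then for all real $x$ and $n\in\mathbb{N}_0$, $$M^{[m-1,r]}_{n}(x;k;a,b,c;\overline{\alpha}_{r})=\sum_{j=0}^{n}\sum_{\ell=j}^{n}(-1)^{j}\ell!\binom{n}{n-\ell}(\ln c)^{\ell}\binom{\ell+\alpha}{\ell-j}L^{(\alpha)}_{j}(x)M^{[m-1,r]}_{n-\ell}(k;a,b,c;\overline{\alpha}_{r}).$$
   Context: $L^{(\alpha)}_j(x)$ denotes the generalized Laguerre polynomial, $L^{(\alpha)}_j(x)=\sum_{i=0}^{j}\binom{j+\alpha}{j-i}\frac{(-x)^i}{i!}$, and $\binom{z}{p}=z(z-1)\cdots(z-p+1)/p!$. The polynomials $M^{[m-1,r]}_{n}(x;k;a,b,c;\overline{\alpha}_{r})$ are the Taylor coefficients at $t=0$ of $$\frac{t^{rkm}2^{rm(1-k)}c^{xt}}{\prod_{i=0}^{r-1}\left(\alpha_{i}b^{t}-a^{t}\sum_{p=0}^{m-1}\frac{t^{p}}{p!}\right)}=\sum_{n=0}^{\infty}M^{[m-1,r]}_{n}(x;k;a,b,c;\overline{\alpha}_{r})\frac{t^{n}}{n!},$$ the parameters being assumed such that this function is analytic near $t=0$; and $M^{[m-1,r]}_{n}(k;a,b,c;\overline{\alpha}_{r}):=M^{[m-1,r]}_{n}(0;k;a,b,c;\overline{\alpha}_{r})$.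 *)

(* Defs.v *)
From Stdlib Require Export Reals ZArith.
From Stdlib Require Import ClassicalEpsilon.
From Coquelicot Require Export Coquelicot.

Open Scope C_scope.

Definition Cexp (z : C) : C :=
  ((exp (Re z) * cos (Im z))%R, (exp (Re z) * sin (Im z))%R).

(** [a ^ z] for a positive real base [a] and a complex exponent [z]. *)
Definition Rcpower (a : R) (z : C) : C := Cexp (z * RtoC (ln a)).

Definition Cfact (n : nat) : C := RtoC (INR (fact n)).

(** Product of [f i] over [i < n]. *)
Fixpoint Cprod (n : nat) (f : nat -> C) : C :=
  match n with
  | O => 1
  | S p => Cprod p f * f p
  end.

Definition Cbinom (z : C) (p : nat) : C :=
  Cprod p (fun i => z - RtoC (INR i)) / Cfact p.

Definition laguerre (alpha : C) (j : nat) (x : C) : C :=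
  sum_n (fun i => Cbinom (RtoC (INR j) + alpha) (j - i) * ((- x) ^ i / Cfact i)) j.

(** [f] is given near [0] by the convergent power series with coefficients
    [u].  The point [0] itself is left out, so that [f] may have a removable
    singularity there: when some [alpha i = 1] and [k > 0], the generating function below
    has the form [0 / 0] at [0]. *)
Definition is_taylor0 (f : C -> C) (u : nat -> C) : Prop :=
  locally' (0 : C) (fun t : C =>
    is_pseries (K := C_AbsRing) (V := C_NormedModule) u t (f t)).

Definition analytic0 (f : C -> C) : Prop := exists u, is_taylor0 f u.

(** The coefficient of [t ^ n] in the expansion of [f] at [0] (an unspecified
    value when [f] is not analytic near [0]). *)
Definition taylor0 (f : C -> C) : nat -> C :=
  epsilon (inhabits (fun _ : nat => 0 : C)) (is_taylor0 f).

(** Only the values [alpha 0], ..., [alpha (r - 1)] are used. The inner sum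
    runs over [0 <= p <= m - 1], so [m] has to be positive. *)
Definition Mgen (m r k : nat) (a b c : R) (alpha : nat -> C) (x : R) (t : C) : C :=
  t ^ (r * k * m)
  * RtoC (powerRZ 2 (Z.of_nat r * Z.of_nat m * (1 - Z.of_nat k))%Z)
  * Rcpower c (RtoC x * t)
  / Cprod r (fun i =>
      alpha i * Rcpower b t
      - Rcpower a t * sum_n (fun p => t ^ p / Cfact p) (m - 1)).

Definition Mpoly (m r n : nat) (x : R) (k : nat) (a b c : R) (alpha : nat -> C) : C :=
  Cfact n * taylor0 (Mgen m r k a b c alpha x) n.

Definition Mnum (m r n : nat) (k : nat) (a b c : R) (alpha : nat -> C) : C :=
  Mpoly m r n 0 k a b c alpha.

(* Main.v *)
Require Import Defs.
From Stdlib Require Import Lra Lia ClassicalEpsilon.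

(** Two facts are combined. First, the generating function at [x] is
    [exp (x t ln c)] times the one at [0], so the polynomial at [x] is a
    convolution of the powers [(x ln c)^l / l!] with the numbers at [0]. Since
    Taylor coefficients are already determined by the values on the real axis,
    this reduces, by taking real and imaginary parts, to a Cauchy product of
    real power series. Second, [x^l] is expanded in Laguerre polynomials: the
    product of the two binomials factors as [binom(l + alpha, l - i)] times
    [binom(l - i, j - i)], and the alternating sum over [j] leaves only [i = l]. *)

(* Equations between sums are typed in the carrier of [C_AbelianMonoid], where
   [ring] and [field] do not find the structure of [C]. *)
Ltac eq_in_C := match goal with |- @eq _ ?y ?z => change (@eq C y z) end.

(** * Reindexing of finite sums *)

Lemma sum_n_m_triangle {G : AbelianMonoid} (f : nat -> nat -> G) (n : nat) :
  sum_n_m (fun j => sum_n_m (f j) j n) 0 n = sum_n (fun l => sum_n (fun j => f j l) l) n.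
Proof.
  induction n as [|n IH].
  - now rewrite sum_O, sum_O, sum_n_n, sum_n_n.
  - rewrite sum_Sn, <- IH, sum_n_Sm, sum_n_n, sum_Sn by lia.
    rewrite plus_assoc. f_equal.
    unfold sum_n. rewrite <- sum_n_m_plus.
    apply sum_n_m_ext_loc; intros j hj. now rewrite sum_n_Sm by lia.
Qed.

Lemma sum_n_m_shift {G : AbelianMonoid} (f : nat -> G) (i p : nat) :
  sum_n_m f i (i + p) = sum_n (fun q => f (i + q)%nat) p.
Proof.
  induction p as [|p IH].
  - now rewrite Nat.add_0_r, sum_n_n, sum_O, Nat.add_0_r.
  - rewrite Nat.add_succ_r, sum_n_Sm, IH, sum_Sn, Nat.add_succ_r by lia.
    reflexivity.
Qed.

Lemma sum_n_last {G : AbelianMonoid} (f : nat -> G) (n : nat) :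
  (forall i, (i < n)%nat -> f i = zero) -> sum_n f n = f n.
Proof.
  intros hf. destruct n as [|n]; [apply sum_O|].
  rewrite sum_Sn, (sum_n_ext_loc f (fun _ => zero)) by (intros; apply hf; lia).
  replace (sum_n (fun _ => zero) n) with (zero : G); [apply plus_zero_l|].
  induction n as [|n IH]; [now rewrite sum_O|].
  rewrite sum_Sn, <- IH; [now rewrite plus_zero_l | intros; apply hf; lia].
Qed.

Lemma sum_n_C_mult_l (z : C) (f : nat -> C) (n : nat) :
  z * sum_n f n = sum_n (fun i => z * f i) n.
Proof. symmetry; exact (sum_n_mult_l (K := C_Ring) z f n). Qed.

Lemma sum_n_RtoC (f : nat -> R) (n : nat) :
  sum_n (fun i => RtoC (f i)) n = RtoC (sum_n f n).
Proof.
  induction n as [|n IH]; [now rewrite !sum_O|].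
  rewrite !sum_Sn, IH. symmetry; apply RtoC_plus.
Qed.

(** * Factorials, binomials and the expansion of powers in Laguerre polynomials *)

Lemma Cfact_neq_0 (n : nat) : Cfact n <> 0.
Proof. intros h. apply (INR_fact_neq_0 n). now injection h. Qed.

(** The binomial expansion of [(-1 + 1) ^ n], divided by [n!]; for [n = 0] this uses [0 ^ 0 = 1]. *)
Lemma alternating_binomial_sum (n : nat) :
  (if Nat.eq_dec n 0 then RtoC 1 else RtoC 0)
  = sum_n (fun i => (- (1)) ^ i / (Cfact i * Cfact (n - i)))%C n.
Proof.
  symmetry. rewrite (sum_n_ext_loc _ (fun i => / Cfact n *
     RtoC (Binomial.C n i * (- (1)) ^ i * 1 ^ (n - i))%R)).
  - rewrite <- sum_n_C_mult_l, sum_n_RtoC, sum_n_Reals, <- binomial.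
    replace (- (1) + 1)%R with 0%R by ring.
    destruct (Nat.eq_dec n 0) as [-> | hn].
    + simpl. unfold Cfact; simpl. field.
    + rewrite pow_i by lia. ring.
  - intros i hi. eq_in_C. rewrite pow1, Rmult_1_r. unfold Binomial.C.
    rewrite RtoC_mult, RtoC_div, RtoC_mult, RtoC_pow, RtoC_opp
      by (apply Rmult_integral_contrapositive; split; apply INR_fact_neq_0).
    fold (Cfact n) (Cfact i) (Cfact (n - i)).
    field. repeat split; apply Cfact_neq_0.
Qed.

Lemma Cprod_ext (n : nat) (f g : nat -> C) :
  (forall i, (i < n)%nat -> f i = g i) -> Cprod n f = Cprod n g.
Proof.
  induction n as [|n IH]; intros hfg; simpl; [easy|].
  rewrite IH, hfg by auto with arith. reflexivity.
Qed.

Lemma Cprod_add (p q : nat) (f : nat -> C) :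
  Cprod (p + q) f = Cprod p f * Cprod q (fun i => f (p + i)%nat).
Proof.
  induction q as [|q IH].
  - rewrite Nat.add_0_r; simpl; ring.
  - rewrite Nat.add_succ_r; simpl. rewrite IH; ring.
Qed.

(** The falling factorial of [z] of length [p + q] is cut after its first [p] factors; the remaining
    ones form the falling factorial of [z - p]. *)
Lemma Cbinom_mul_Cbinom (z : C) (p q : nat) :
  Cbinom z p * Cbinom (z - RtoC (INR p)) q
  = Cbinom z (p + q) * Cfact (p + q) / (Cfact p * Cfact q).
Proof.
  unfold Cbinom. rewrite Cprod_add.
  rewrite (Cprod_ext q (fun i => z - RtoC (INR p) - RtoC (INR i))
             (fun i => z - RtoC (INR (p + i)))).
  - field. repeat split; apply Cfact_neq_0.
  - intros i _. rewrite plus_INR, RtoC_plus. ring.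
Qed.

Lemma Cprod_INR_fact (n p : nat) : (p <= n)%nat ->
  Cprod p (fun i => RtoC (INR n) - RtoC (INR i)) * Cfact (n - p) = Cfact n.
Proof.
  induction p as [|p IH]; intros hp; simpl Cprod.
  - rewrite Nat.sub_0_r; ring.
  - rewrite <- IH by lia.
    replace (n - p)%nat with (S (n - S p)) by lia.
    unfold Cfact. rewrite fact_simpl, mult_INR, RtoC_mult.
    replace (S (n - S p)) with (n - p)%nat by lia.
    rewrite minus_INR, RtoC_minus by lia. ring.
Qed.

Lemma Cbinom_INR (n p : nat) : (p <= n)%nat ->
  Cbinom (RtoC (INR n)) p = Cfact n / (Cfact p * Cfact (n - p)).
Proof.
  intros hp. unfold Cbinom. rewrite <- (Cprod_INR_fact n p hp).
  field; split; apply Cfact_neq_0.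
Qed.

Lemma pow_laguerre (alpha : C) (l : nat) (x : C) :
  x ^ l = Cfact l *
    sum_n (fun j => (- (1)) ^ j * Cbinom (RtoC (INR l) + alpha) (l - j)
                    * laguerre alpha j x) l.
Proof.
  (* The index [i] of the monomial comes first, so that exchanging the sums leaves an inner sum over
     [j] from [i] to [l]. *)
  pose (e := fun i j : nat => (- (1)) ^ j * Cbinom (RtoC (INR l) + alpha) (l - j)
    * (Cbinom (RtoC (INR j) + alpha) (j - i) * ((- x) ^ i / Cfact i))).
  rewrite (sum_n_ext _ (fun j => sum_n (fun i => e i j) j))
    by (intros j; apply sum_n_C_mult_l).
  rewrite <- sum_n_m_triangle.
  assert (hinner : forall i, (i <= l)%nat ->
    sum_n_m (e i) i l
    = Cbinom (RtoC (INR l) + alpha) (l - i) * Cfact (l - i) * (x ^ i / Cfact i)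
      * (if Nat.eq_dec (l - i) 0 then RtoC 1 else RtoC 0)).
  { intros i hi.
    replace l with (i + (l - i))%nat at 1 by lia.
    rewrite sum_n_m_shift, alternating_binomial_sum, sum_n_C_mult_l.
    apply sum_n_ext_loc; intros q hq. eq_in_C. unfold e.
    replace (l - (i + q))%nat with (l - i - q)%nat by lia.
    replace (i + q - i)%nat with q by lia.
    (* With [j = i + q], the top [j + alpha] equals [(l + alpha) - (l - j)]: the top of the first
       binomial lowered by its bottom, as [Cbinom_mul_Cbinom] requires. *)
    replace (RtoC (INR (i + q)) + alpha)
      with (RtoC (INR l) + alpha - RtoC (INR (l - i - q))).
    2:{ rewrite !minus_INR, !plus_INR, !RtoC_minus, !RtoC_plus by lia. ring. }
    transitivity ((- (1)) ^ (i + q) * ((- x) ^ i / Cfact i) *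
      (Cbinom (RtoC (INR l) + alpha) (l - i - q)
       * Cbinom (RtoC (INR l) + alpha - RtoC (INR (l - i - q))) q)); [ring|].
    rewrite Cbinom_mul_Cbinom.
    replace (l - i - q + q)%nat with (l - i)%nat by lia.
    rewrite Cpow_add_r.
    replace (x ^ i) with ((- (1)) ^ i * (- x) ^ i)
      by (rewrite <- Cpow_mult_l; f_equal; ring).
    field. repeat split; apply Cfact_neq_0. }
  rewrite (sum_n_m_ext_loc _ (fun i =>
    Cbinom (RtoC (INR l) + alpha) (l - i) * Cfact (l - i) * (x ^ i / Cfact i)
      * (if Nat.eq_dec (l - i) 0 then RtoC 1 else RtoC 0))) by (intros; apply hinner; lia).
  fold (sum_n (fun i =>
    Cbinom (RtoC (INR l) + alpha) (l - i) * Cfact (l - i) * (x ^ i / Cfact i)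
      * (if Nat.eq_dec (l - i) 0 then RtoC 1 else RtoC 0)) l).
  rewrite sum_n_last.
  - rewrite Nat.sub_diag; simpl. unfold Cbinom; simpl.
    field. split; apply Cfact_neq_0.
  - intros i hi. destruct (Nat.eq_dec (l - i) 0); [lia|]. apply Cmult_0_r.
Qed.

(** * Real power series near 0 *)

(** Convergence at [x] makes the terms tend to 0, which fails outside the disk of convergence; hence
    the radius is at least [x]. *)
Lemma CV_radius_gt_of_ex_pseries (a : nat -> R) (x : R) :
  (0 < x)%R -> ex_pseries a x -> Rbar_lt 0 (CV_radius a).
Proof.
  intros hx hex.
  destruct (Rbar_lt_dec (CV_radius a) (Rabs x)) as [hlt | hge].
  - exfalso. apply (CV_disk_outside _ _ hlt), ex_series_lim_0.
    eapply ex_series_ext; [|apply hex].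
    intros n; simpl. rewrite pow_n_pow. unfold scal; simpl; unfold mult; simpl; ring.
  - apply Rbar_not_lt_le in hge.
    apply Rbar_lt_le_trans with (2 := hge); simpl.
    now apply Rabs_pos_lt, Rgt_not_eq.
Qed.

Lemma CV_radius_gt_of_locally' (a : nat -> R) (F : R -> R) :
  locally' 0%R (fun t => is_pseries a t (F t)) -> Rbar_lt 0 (CV_radius a).
Proof.
  intros [d hd].
  apply (CV_radius_gt_of_ex_pseries a (d / 2)).
  - destruct d; simpl; lra.
  - exists (F (d / 2)%R). apply hd; destruct d as [d hd']; simpl in *.
    + unfold ball; simpl; unfold AbsRing_ball, abs, minus, plus, opp; simpl.
      rewrite Rabs_pos_eq; lra.
    + lra.
Qed.

(** Punctured neighbourhoods are used because [is_taylor0] says nothing about the value at 0. *)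
Lemma pseries_unique_locally' (a b : nat -> R) (F : R -> R) (n : nat) :
  locally' 0%R (fun t => is_pseries a t (F t)) ->
  locally' 0%R (fun t => is_pseries b t (F t)) -> a n = b n.
Proof.
  intros ha hb.
  pose proof (CV_radius_gt_of_locally' _ _ ha) as ra.
  pose proof (CV_radius_gt_of_locally' _ _ hb) as rb.
  assert (hab : locally' 0%R (fun t => PSeries a t = PSeries b t)).
  { generalize (filter_and _ _ ha hb); apply filter_imp; intros t [h1 h2].
    now rewrite (is_pseries_unique _ _ _ h1), (is_pseries_unique _ _ _ h2). }
  (* The hypotheses omit [t = 0], which is recovered by continuity. *)
  assert (h0 : PSeries a 0 = PSeries b 0).
  { assert (hlim : forall u, Rbar_lt 0 (CV_radius u) ->
      is_lim (PSeries u) 0 (PSeries u 0)).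
    { intros u hu. apply is_lim_continuity, PSeries_continuity.
      now rewrite Rabs_R0. }
    assert (h : Finite (PSeries a 0) = Finite (PSeries b 0)).
    { rewrite <- (is_lim_unique _ _ _ (hlim a ra)).
      rewrite <- (is_lim_unique _ _ _ (hlim b rb)).
      now symmetry; apply Lim_ext_loc. }
    now injection h. }
  apply PSeries_ext_recip; [assumption..|].
  destruct hab as [d hd]; exists d; intros t ht.
  destruct (Req_dec t 0) as [-> | hne]; [exact h0 | now apply hd].
Qed.

(** The Cauchy product of the exponential series and [a] also sums to [exp (s * t) * F t], so
    uniqueness identifies it with [b]. *)
Lemma pseries_exp_mult (s : R) (a b : nat -> R) (F : R -> R) (n : nat) :
  locally' 0%R (fun t => is_pseries a t (F t)) ->
  locally' 0%R (fun t => is_pseries b t (exp (s * t) * F t)%R) ->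
  b n = sum_f_R0 (fun l => (s ^ l / INR (fact l) * a (n - l)%nat)%R) n.
Proof.
  intros ha hb.
  pose (e := fun l => (s ^ l / INR (fact l))%R).
  change (b n = PS_mult e a n).
  apply (pseries_unique_locally' _ _ _ _ hb).
  assert (he : forall t, is_pseries e t (exp (s * t))).
  { intros t. generalize (is_exp_Reals (s * t)). apply is_series_ext.
    intros l.
    change ((pow_n (K := R_AbsRing) (s * t) l * / INR (fact l))%R
            = (pow_n (K := R_AbsRing) t l * e l)%R).
    rewrite (pow_n_pow (s * t)), (pow_n_pow t), Rpow_mult_distr.
    unfold e, Rdiv; ring. }
  pose proof (CV_radius_gt_of_locally' _ _ ha) as ra.
  assert (re : Rbar_lt 0 (CV_radius e)).
  { apply (CV_radius_gt_of_ex_pseries e 1); [lra | eexists; apply he]. }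
  (* The product theorem needs [t] strictly inside both disks of convergence. *)
  assert (hsmall : forall u, Rbar_lt 0 (CV_radius u) ->
    locally' 0%R (fun t => Rbar_lt (Rabs t) (CV_radius u))).
  { intros u hu. apply filter_le_within.
    destruct (CV_radius u) as [ru | |]; simpl in hu.
    - exists (mkposreal ru hu). intros t ht.
      unfold ball in ht; simpl in ht; unfold AbsRing_ball, abs, minus, plus, opp in ht; simpl in ht.
      now rewrite Ropp_0, Rplus_0_r in ht.
    - now apply filter_forall.
    - easy. }
  generalize (filter_and _ _ ha (filter_and _ _ (hsmall _ ra) (hsmall _ re))).
  apply filter_imp; intros t (h1 & h2 & h3).
  now apply is_pseries_mult.
Qed.

(** * From complex expansions to real ones *)

(** Meant for real and imaginary parts. At real [t] the powers are real scalars, so a real-linear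
    [p] passes through partial sums, and continuity carries it to the limit. *)
Lemma is_pseries_proj (p : C -> R) :
  (forall y z, p (y + z) = (p y + p z)%R) ->
  (forall (t : R) z, p (RtoC t * z) = (t * p z)%R) ->
  (forall z : C_NormedModule, filterlim p (locally z) (locally (p z))) ->
  forall (u : nat -> C) (t : R) (w : C),
  is_pseries (K := C_AbsRing) (V := C_NormedModule) u (RtoC t) w ->
  is_pseries (fun n => p (u n)) t (p w).
Proof.
  intros padd pscal pcont u t w h.
  apply (filterlim_ext (fun n => p (sum_n
    (fun k => scal (V := C_NormedModule) (pow_n (K := C_AbsRing) (RtoC t) k) (u k)) n))).
  - assert (hpow : forall k, pow_n (K := C_AbsRing) (RtoC t) k = RtoC (t ^ k)).
    { induction k as [|k IH]; [easy|]. simpl pow_n. rewrite IH.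
      symmetry; apply RtoC_mult. }
    assert (hterm : forall k,
      p (scal (V := C_NormedModule) (pow_n (K := C_AbsRing) (RtoC t) k) (u k))
      = scal (pow_n t k) (p (u k))).
    { intros k. rewrite hpow, (pow_n_pow t k : pow_n t k = _). apply pscal. }
    induction x as [|x IH]; [now rewrite !sum_O|].
    rewrite !sum_Sn, <- IH, <- hterm. apply padd.
  - exact (filterlim_comp _ _ _ _ p _ _ _ h (pcont w)).
Qed.

Lemma is_taylor0_real_axis (f : C -> C) (u : nat -> C) :
  is_taylor0 f u ->
  locally' 0%R (fun t : R =>
    is_pseries (K := C_AbsRing) (V := C_NormedModule) u (RtoC t) (f (RtoC t))).
Proof.
  intros [d hd]. exists d. intros t ht hne. apply hd.
  (* A ball of [C] is a product of real balls, so the same radius [d] serves on the axis. *)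
  - split; [exact ht | apply ball_center].
  - intros heq. apply hne. now injection heq.
Qed.

Lemma taylor0_exp_mult (s : R) (f g : C -> C) (u v : nat -> C) :
  is_taylor0 f u -> is_taylor0 g v ->
  (forall t : R, g (RtoC t) = RtoC (exp (s * t)) * f (RtoC t)) ->
  forall n, v n = sum_n (fun l => RtoC s ^ l / Cfact l * u (n - l)%nat) n.
Proof.
  intros hu hv hfg n.
  assert (hp : forall p : C -> R,
    (forall y z, p (y + z) = (p y + p z)%R) ->
    (forall (t : R) z, p (RtoC t * z) = (t * p z)%R) ->
    (forall z : C_NormedModule, filterlim p (locally z) (locally (p z))) ->
    p (v n) = p (sum_n (fun l => RtoC s ^ l / Cfact l * u (n - l)%nat) n)).
  { intros p padd pscal pcont.
    rewrite (pseries_exp_mult s (fun k => p (u k)) (fun k => p (v k))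
               (fun t => p (f (RtoC t)))).
    - rewrite <- sum_n_Reals.
      assert (hcoef : forall l, p (RtoC s ^ l / Cfact l * u (n - l)%nat)
        = (s ^ l / INR (fact l) * p (u (n - l)%nat))%R).
      { intros l. rewrite <- pscal. unfold Cfact.
        now rewrite RtoC_div, RtoC_pow by apply INR_fact_neq_0. }
      (* Only the summation bounds are generalized; the [n] in [u (n - l)] stays fixed during the
         induction. *)
      generalize n at 2 4 as N.
      induction N as [|N IH]; [now rewrite !sum_O, hcoef|].
      rewrite !sum_Sn, IH, <- hcoef. symmetry; apply padd.
    - generalize (is_taylor0_real_axis _ _ hu). apply filter_imp.
      intros t. now apply is_pseries_proj.
    - generalize (is_taylor0_real_axis _ _ hv). apply filter_imp.
      intros t h. rewrite <- pscal, <- hfg. revert h. now apply is_pseries_proj. }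
  apply injective_projections.
  - apply hp; [easy | intros; simpl; ring | intros z; apply continuous_fst].
  - apply hp; [easy | intros; simpl; ring | intros z; apply continuous_snd].
Qed.

(** Analyticity provides the witness that keeps [epsilon] from returning an arbitrary sequence. *)
Lemma taylor0_spec (f : C -> C) : analytic0 f -> is_taylor0 f (taylor0 f).
Proof. apply epsilon_spec. Qed.

(** * The generating function and the expansion *)

Lemma Rcpower_real (c y : R) : Rcpower c (RtoC y) = RtoC (exp (y * ln c)).
Proof.
  unfold Rcpower. rewrite <- RtoC_mult. unfold Cexp; simpl.
  rewrite cos_0, sin_0. unfold RtoC. f_equal; ring.
Qed.

(** The variable [x] enters only through [c ^ (x t)]. The denominator is kept as a formal inverse,
    so its zeros need no separate case. *)
Lemma Mgen_real (m r k : nat) (a b c : R) (alphas : nat -> C) (x t : R) :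
  Mgen m r k a b c alphas x (RtoC t)
  = RtoC (exp (x * ln c * t)) * Mgen m r k a b c alphas 0 (RtoC t).
Proof.
  unfold Mgen. rewrite <- !RtoC_mult, (Rcpower_real c (x * t)), (Rcpower_real c (0 * t)).
  rewrite !Rmult_0_l, exp_0.
  replace (x * ln c * t)%R with (x * t * ln c)%R by ring.
  unfold Cdiv; ring.
Qed.

Theorem theorem4p3
  (a b c : R) (ha : (0 < a)%R) (hb : (0 < b)%R) (hc : (0 < c)%R) (hab : a <> b)
  (m : nat) (hm : (0 < m)%nat) (k : nat) (r : nat) (hr : (0 < r)%nat)
  (alphas : nat -> C) (alpha : C)
  (hanalytic : forall y : R, analytic0 (Mgen m r k a b c alphas y)) :
  forall (x : R) (n : nat),
    Mpoly m r n x k a b c alphas =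
    sum_n_m (fun j : nat =>
      sum_n_m (fun l : nat =>
        (- (1)) ^ j * Cfact l * Cbinom (RtoC (INR n)) (n - l)
        * RtoC (ln c) ^ l * Cbinom (RtoC (INR l) + alpha) (l - j)
        * laguerre alpha j (RtoC x) * Mnum m r (n - l) k a b c alphas)
        j n) 0 n.
Proof.
  intros x n.
  (* With [l] outermost, the two sides can be compared term by term with the convolution. *)
  rewrite sum_n_m_triangle.
  unfold Mnum, Mpoly.
  rewrite (taylor0_exp_mult (x * ln c)%R _ _ _ _
    (taylor0_spec _ (hanalytic 0%R)) (taylor0_spec _ (hanalytic x))
    (Mgen_real m r k a b c alphas x)).
  rewrite sum_n_C_mult_l.
  apply sum_n_ext_loc; intros l hl. eq_in_C.
  rewrite RtoC_mult, Cpow_mult_l, (pow_laguerre alpha l (RtoC x)).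
  rewrite Cbinom_INR by lia.
  replace (n - (n - l))%nat with l by lia.
  set (mu := taylor0 _ _).
  (* The [l!] from [pow_laguerre] cancels the exponential coefficient [1 / l!]; on the other side
     [l!], [binom(n, n - l)] and the [(n - l)!] inside [Mnum] multiply to [n!]. *)
  transitivity (Cfact n * RtoC (ln c) ^ l * mu
    * sum_n (fun j => (- (1)) ^ j * Cbinom (RtoC (INR l) + alpha) (l - j)
                      * laguerre alpha j (RtoC x)) l).
  - field. apply Cfact_neq_0.
  - rewrite sum_n_C_mult_l. apply sum_n_ext; intros j. eq_in_C.
    field. split; apply Cfact_neq_0.
Qed.
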